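(* Let $A=A^\top\in\mathbb{R}^{n\times n}$ be such that the undirected graph $\mathcal{G}(A)$ is a tree, and let $B=\mathbf{e}_1\in\mathbb{R}^n$ (so that node $1$ is the single leader). Let $\mathcal{F}_0=\{1\}$, let $\mathcal{F}_d$ be the set of nodes at distance $d$ from node $1$, and let $k$ be the maximum distance of a node from node $1$; nodes are numbered by nondecreasing distance from node $1$. If, for every $d\in\{0,\dots,k-1\}$, all the edges from the vertices in $\mathcal{F}_d$ to the vertices in $\mathcal{F}_{d+1}$ have the same sign, then the pair $(A,B)$ is herdable.
   Context: Graph of a matrix: for a symmetric $A\in\mathbb{R}^{n\times n}$, $\mathcal{G}(A)$ is the signed weighted undirected graph with node set $\{1,\dots,n\}$ and an edge between $j$ and $i$ if and only if $[A]_{ij}=[A]_{ji}\neq 0$, with weight (hence sign) that of $[A]_{ij}$. It is a tree if it is connected and acyclic (in particular without self-loops, so $A$ has zero diagonal). The distance between two nodes is the minimum number of edges of a walk joining them. $\mathbf{e}_1$ is the first canonical basis vector. Herdability: a pair $(A,B)$, $A\in\mathbb{R}^{n\times n}$, $B\in\mathbb{R}^{n\times m}$, describing the linear time-invariant (continuous-time or discrete-time) system $\dot{\mathbf x}=A\mathbf{x}+B\mathbf{u}$ or $\mathbf{x}(t+1)=A\mathbf{x}(t)+B\mathbf{u}(t)$, is herdable if for every $\mathbf{x}(0)$ and every $h>0$ there exist $t_f>0$ and an input $\mathbf{u}(t)$, $t\in[0,t_f)$, driving the state from $\mathbf{x}(0)$ to $\mathbf{x}(t_f)\ge h\mathbf{1}_n$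 (entrywise). It is known that this is equivalent to the image of the controllability matrix $\mathcal{R}(A,B)=[B\ \ AB\ \ \cdots\ \ A^{n-1}B]$ containing a vector with all entries strictly positive. *)

(* Defs.v *)
From mathcomp Require Import all_boot all_order all_algebra.
From mathcomp Require Import all_classical all_reals all_analysis.

Set Implicit Arguments.
Unset Strict Implicit.
Unset Printing Implicit Defensive.

Import Order.TTheory GRing.Theory Num.Theory.
Import numFieldNormedType.Exports.

Local Open Scope classical_set_scope.
Local Open Scope ring_scope.

(* A graph is an adjacency relation [e] on a finite type; in [is_tree] and
   [gdist], [e] is meant to be symmetric. *)

(* The bound on [size c] is needed because x, y, x along a single undirected
   edge is a cycle for [cycle]; self-loops are excluded separately. *)
Definition is_tree (V : finType) (e : rel V) : Prop :=
  [/\ (forall x y : V, connect e x y),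
      (forall x : V, ~~ e x x) &
      (forall c : seq V, uniq c -> cycle e c -> (size c <= 2)%N)].

Definition walk (V : finType) (e : rel V) (x y : V) (d : nat) : bool :=
  [exists p : d.-tuple V, path e x p && (last x p == y)].

(* A shortest walk has fewer than #|V| edges, so the search below finds the
   minimum length; the value is #|V| if x and y are not connected. *)
Definition gdist (V : finType) (e : rel V) (x y : V) : nat :=
  find (walk e x y) (iota 0 #|V|).

Definition layer (V : finType) (e : rel V) (r : V) (d : nat) : {set V} :=
  [set v | gdist e r v == d].

Definition eccentricity (V : finType) (e : rel V) (r : V) : nat :=
  \max_(v : V) gdist e r v.

Definition mx_edge (R : realType) (n : nat) (A : 'M[R]_n) : rel 'I_n :=
  [rel i j | A i j != 0].

Definition same_sign_edges (R : realType) (n : nat) (A : 'M[R]_n)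
    (S T : {set 'I_n}) : Prop :=
  forall i j i' j' : 'I_n, i \in S -> j \in T -> i' \in S -> j' \in T ->
    mx_edge A i j -> mx_edge A i' j' -> Num.sg (A i j) = Num.sg (A i' j').

(* Inputs are continuous, so that trajectories are classical solutions. As this
   class is contained in the other usual ones (piecewise continuous, locally
   integrable), herdability with continuous inputs implies herdability with
   those. *)
Definition ct_trajectory (R : realType) (n m : nat)
    (A : 'M[R]_n) (B : 'M[R]_(n, m)) (tf : R)
    (u : R -> 'cV[R]_m) (x : R -> 'cV[R]_n) : Prop :=
  [/\ {within `[0, tf], continuous u},
      {within `[0, tf], continuous x} &
      forall t : R, 0 < t < tf -> is_derive t 1 x (A *m x t + B *m u t)].

Definition ct_herdable (R : realType) (n m : nat)
    (A : 'M[R]_n) (B : 'M[R]_(n, m)) : Prop :=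
  forall (x0 : 'cV[R]_n) (h : R), 0 < h ->
    exists tf : R, 0 < tf /\
    exists (u : R -> 'cV[R]_m) (x : R -> 'cV[R]_n),
      [/\ ct_trajectory A B tf u x, x 0 = x0 &
          forall i : 'I_n, h <= x tf i ord0].

Definition dt_trajectory (R : realType) (n m : nat)
    (A : 'M[R]_n) (B : 'M[R]_(n, m)) (tf : nat)
    (u : nat -> 'cV[R]_m) (x : nat -> 'cV[R]_n) : Prop :=
  forall t : nat, (t < tf)%N -> x t.+1 = A *m x t + B *m u t.

Definition dt_herdable (R : realType) (n m : nat)
    (A : 'M[R]_n) (B : 'M[R]_(n, m)) : Prop :=
  forall (x0 : 'cV[R]_n) (h : R), 0 < h ->
    exists tf : nat, (0 < tf)%N /\
    exists (u : nat -> 'cV[R]_m) (x : nat -> 'cV[R]_n),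
      [/\ dt_trajectory A B tf u x, x 0%N = x0 &
          forall i : 'I_n, h <= x tf i ord0].

(* The same pair (A, B) describes a continuous-time and a discrete-time system;
   herdability is required of both. *)
Definition herdable (R : realType) (n m : nat)
    (A : 'M[R]_n) (B : 'M[R]_(n, m)) : Prop :=
  ct_herdable A B /\ dt_herdable A B.

(* Main.v *)
(* On layer d of the graph the vector A ^ d e_1 collects the signed weights of
   the walks of length d from the leader.  These all run from layer to layer, so
   by the sign hypothesis they have a common sign, whereas A ^ d e_1 vanishes on
   the farther layers.  Hence some combination of the vectors A ^ d e_1 is
   positive, and it remains to reach such a vector, scaled up enough to dominate
   the free response.  In discrete time n + 1 steps do.  In continuous time, the
   ansatz y(t) = \sum_k p_k(t) A ^ k b reduces y' = A y + b u, through the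
   Cayley-Hamilton theorem, to p_(k-1) = p_k' + chi_k p_n with the
   coefficients chi_k of the characteristic polynomial: p_n is a polynomial that
   can be chosen freely, and a multiple of X ^ (n + 1) with suitable derivatives
   at 1 makes y vanish at 0 and y(1) any prescribed combination. *)
Require Import Defs.
From mathcomp Require Import all_boot all_order all_algebra.
From mathcomp Require Import all_classical all_reals all_analysis.

Import Order.TTheory GRing.Theory Num.Theory.
Import numFieldNormedType.Exports.

Local Open Scope ring_scope.

(** * Walks and distances in a graph *)

Lemma gdist_le {V : finType} {e : rel V} {x y : V} {d : nat} :
  walk e x y d -> (gdist e x y <= d)%N.
Proof.
move=> w; rewrite leqNgt; apply/negP => lt_d.
have /(before_find 0%N) := lt_d.
rewrite nth_iota ?w // (leq_trans lt_d) //.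
by rewrite -[leqRHS](size_iota 0); exact: find_size.
Qed.

(** A walk without repeated nodes is short enough for the bounded search in [gdist], which therefore
    never returns its default value on connected nodes. *)
Lemma connect_walk {V : finType} {e : rel V} {x y : V} :
  connect e x y -> exists2 d, (d < #|V|)%N & walk e x y d.
Proof.
move=> /connectP[p pp ->]; case/shortenP: pp => q qp qu _.
exists (size q).
  by have /card_uniqP /= <- := qu; exact: max_card.
by apply/existsP; exists (in_tuple q); rewrite qp eqxx.
Qed.

Lemma gdist_walk {V : finType} {e : rel V} {x y : V} :
  connect e x y -> (gdist e x y < #|V|)%N /\ walk e x y (gdist e x y).
Proof.
move=> /connect_walk[d dV w].
have hw : has (walk e x y) (iota 0 #|V|).
  by apply/hasP; exists d => //; rewrite mem_iota.
have lt_g : (gdist e x y < #|V|)%N by rewrite -[ltnRHS](size_iota 0) -has_find.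
by split=> //; have := nth_find 0%N hw; rewrite nth_iota.
Qed.

Lemma walkS {V : finType} {e : rel V} {x y z : V} {d : nat} :
  walk e x y d -> e y z -> walk e x z d.+1.
Proof.
move=> /existsP[p /andP[pp /eqP py]] eyz.
apply/existsP; exists [tuple of rcons p z].
by rewrite /= rcons_path pp py eyz last_rcons eqxx.
Qed.

Lemma walkSP {V : finType} {e : rel V} {x z : V} {d : nat} :
  walk e x z d.+1 -> exists2 y, walk e x y d & e y z.
Proof.
move=> /existsP[[p /= sp] /andP[pp /eqP pz]].
case/lastP: p sp pp pz => // p w; rewrite size_rcons eqSS => sp.
rewrite rcons_path last_rcons => /andP[pp ew] <-.
exists (last x p) => //.
by apply/existsP; exists (Tuple sp); rewrite /= pp eqxx.
Qed.

Lemma walk0 {V : finType} {e : rel V} {x y : V} : walk e x y 0 = (x == y).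
Proof.
apply/existsP/idP => [[p]|xy]; first by rewrite (tuple0 p).
by exists [tuple].
Qed.

(** * Signs of the Krylov vectors of the leader, layer by layer *)

Section LeaderColumn.
Context {R : realType} {n : nat} (A : 'M[R]_n.+1).
Local Notation dist := (gdist (mx_edge A) ord0).
Local Notation e1 := (delta_mx ord0 ord0 : 'cV[R]_n.+1).
Local Notation krylov k := (A ^+ k *m e1).

Lemma krylovS k i : krylov k.+1 i ord0 = \sum_j A i j * krylov k j ord0.
Proof. by rewrite exprS -mulmxE -mulmxA mxE. Qed.

Hypothesis symA : A = A^T.
Hypothesis connA : forall x y, connect (mx_edge A) x y.

Lemma symAE i j : A i j = A j i.
Proof. by rewrite {1}symA mxE. Qed.

Lemma gdist_edge i j : A i j != 0 -> (dist i <= (dist j).+1)%N.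
Proof.
move=> Aij; apply: gdist_le; apply: (walkS (gdist_walk (connA _ j)).2).
by rewrite /mx_edge /= symAE.
Qed.

(** Each multiplication by [A] spreads the support by at most one layer. *)
Lemma krylov_far k i : (k < dist i)%N -> krylov k i ord0 = 0.
Proof.
elim: k i => [|k IHk] i ki.
  rewrite expr0 mul1mx mxE; case: eqP => // i0; move: ki; rewrite i0.
  have /gdist_le : walk (mx_edge A) ord0 ord0 0 by rewrite walk0.
  by rewrite leqNgt => /negPf->.
rewrite krylovS big1 // => j _.
have [->|Aij] := eqVneq (A i j) 0; first by rewrite mul0r.
by rewrite IHk ?mulr0 // -ltnS (leq_trans ki) ?gdist_edge.
Qed.

Hypothesis signA : forall d : nat, (d < eccentricity (mx_edge A) ord0)%N ->
  same_sign_edges A (layer (mx_edge A) ord0 d) (layer (mx_edge A) ord0 d.+1).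

(** A neighbour of a node of layer [d.+1] lies in layer [d] or farther, and by [krylov_far] the
    farther ones contribute nothing. Only the edges from layer [d] remain, and these share one
    sign. *)
Lemma krylov_layer d :
  exists s : R, forall i, dist i = d -> 0 < s * krylov d i ord0.
Proof.
elim: d => [|d [s IHd]].
  exists 1 => i i0; have := (gdist_walk (connA ord0 i)).2.
  by rewrite i0 walk0 => /eqP <-; rewrite expr0 mul1mx mul1r mxE eqxx ltr01.
have pred_layer i : dist i = d.+1 -> exists2 j, dist j = d & A j i != 0.
  move=> id; have := (gdist_walk (connA ord0 i)).2; rewrite id.
  move=> /walkSP[j wj eji]; exists j => //.
  apply/eqP; rewrite eqn_leq (gdist_le wj) -ltnS -id gdist_edge //.
  by rewrite symAE.
have [[i0 i0d]|no_layer] := pselect (exists i, dist i = d.+1); last first.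
  by exists 1 => i id; case: no_layer; exists i.
have [j0 j0d Aj0] := pred_layer i0 i0d.
have d_ecc : (d < eccentricity (mx_edge A) ord0)%N.
  by rewrite /eccentricity -i0d; exact: (leq_bigmax (F := dist)).
(* By [signA], the edge between [j0] and [i0] represents the sign of all edges between the two
   layers. *)
exists (Num.sg (A j0 i0) * s) => i id.
have term j : dist j = d -> A j i != 0 ->
    0 < Num.sg (A j0 i0) * s * (A i j * krylov d j ord0).
  move=> jd Aji; rewrite mulrACA (symAE i j).
  have -> : Num.sg (A j0 i0) = Num.sg (A j i).
    have := signA d d_ecc j0 i0 j i; rewrite /layer !inE i0d j0d id jd !eqxx.
    exact.
  by rewrite -normrEsg mulr_gt0 ?normr_gt0 ?IHd.
have [j jd Aji] := pred_layer i id.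
rewrite krylovS mulr_sumr (bigD1 j) //= ltr_pwDl ?term //.
apply: sumr_ge0 => k _; have [Aki|Aki] := eqVneq (A k i) 0.
  by rewrite (symAE i k) Aki mul0r mulr0.
have [dk|kd] := ltnP d (dist k); first by rewrite krylov_far ?mulr0.
have ik : A i k != 0 by rewrite (symAE i k).
by apply/ltW/term => //; apply/eqP; rewrite eqn_leq kd -ltnS -id gdist_edge.
Qed.

(* Descending on the layers: adding a large multiple of [A ^ d e1] makes layer
   [d] positive and leaves the farther layers unchanged. *)
Lemma krylov_pos :
  exists c : nat -> R, forall i, 0 < (\sum_(k < n.+1) c k *: krylov k) i ord0.
Proof.
suff pos m : (m <= n.+1)%N -> exists c : nat -> R, forall i,
    (m <= dist i)%N -> 0 < (\sum_(m <= k < n.+1) c k *: krylov k) i ord0.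
  have [c cP] := pos 0%N isT; exists c => i.
  by rewrite -(big_mkord predT (fun k => c k *: krylov k)) cP.
move=> mn; rewrite -(subKn mn).
(* The induction starts from [m = n.+1], a distance that no node attains. *)
elim: (n.+1 - m)%N (leq_subr m n.+1) => [|l IHl] ln.
  exists (fun=> 0) => i; rewrite subn0 leqNgt -[X in (_ < X)%N](card_ord n.+1).
  by rewrite (gdist_walk (connA ord0 i)).1.
have [c cP] := IHl (ltnW ln).
have [s sP] := krylov_layer (n.+1 - l.+1).
set d := (n.+1 - l.+1)%N in sP *.
have dS : d.+1 = (n.+1 - l)%N by rewrite /d -subSn.
pose w := \sum_(d.+1 <= k < n.+1) c k *: krylov k.
(* On layer [d], this [t] strictly exceeds the modulus of the quotient, so the entry of [w] cannot
   cancel the new term. The summands of other nodes can only increase [t]. *)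
pose t := \sum_i `|w i ord0 / (s * krylov d i ord0)| + 1.
exists (fun k => if k == d then t * s else c k) => i di.
have -> : \sum_(d <= k < n.+1) (if k == d then t * s else c k) *: krylov k
    = (t * s) *: krylov d + w.
  rewrite big_ltn ?eqxx; last by rewrite dS leq_subr.
  by congr (_ + _); apply: eq_big_nat => k /andP[dk _]; rewrite gtn_eqF.
rewrite mxE [X in X + _]mxE.
have [id|nid] := eqVneq (dist i) d; last first.
  have lt_d : (d < dist i)%N by rewrite ltn_neqAle eq_sym nid.
  by rewrite krylov_far // mulr0 add0r /w dS cP // -dS.
have p_gt0 := sP i id.
rewrite -mulrA -[w i ord0](divfK (lt0r_neq0 p_gt0)) -mulrDl mulr_gt0 //.
have : `|w i ord0 / (s * krylov d i ord0)| < t.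
  rewrite /t (bigD1 i) //= -addrA ltrDl ltr_wpDl ?ltr01 //.
  by apply: sumr_ge0.
by rewrite ltr_norml -subr_gt0 opprK addrC => /andP[].
Qed.

End LeaderColumn.

(** * Differentiation of matrix functions and the free response in continuous time *)

Lemma is_derive_mx {R : realType} {m p : nat}
    (M M' : R -> 'M[R]_(m, p)) (t : R) :
  (forall i j, is_derive t 1 (fun s => M s i j) (M' t i j)) ->
  is_derive t 1 M (M' t).
Proof.
move=> dM; have derM : derivable M t 1.
  by apply/derivable_mxP => i j; have [] := dM i j.
apply: DeriveDef => //; rewrite derive_mx //.
by apply/matrixP => i j; rewrite mxE; have [] := dM i j.
Qed.

Section FreeResponse.
Context {R : realType} {n : nat} (A : 'M[R]_n.+1).

Definition free_coef (v : 'cV[R]_n.+1) (i : 'I_n.+1) (k : nat) : R :=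
  (A ^+ k *m v) i ord0 / k`!%:R.

(* This is exp(t A) v, by one power series per entry. *)
Definition free_response (v : 'cV[R]_n.+1) (t : R) : 'cV[R]_n.+1 :=
  \col_i limn (pseries (free_coef v i) t).

(** The sum of the moduli of all entries of [A] bounds every row sum, hence the growth at each
    multiplication by [A]. *)
Lemma powmx_bound (v : 'cV[R]_n.+1) k i :
  `|(A ^+ k *m v) i ord0| <=
    (\sum_j `|v j ord0|) * (\sum_l \sum_j `|A l j|) ^+ k.
Proof.
elim: k i => [|k IHk] i.
  by rewrite !expr0 mul1mx mulr1 (bigD1 i) //= ler_wpDr // sumr_ge0.
rewrite !exprS -mulmxE -mulmxA mxE mulrCA.
apply: (le_trans (ler_norm_sum _ _ _)).
set c := _ * _ ^+ k in IHk *.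
have c_ge0 : 0 <= c by apply: le_trans (IHk ord0).
apply: (@le_trans _ _ (\sum_j `|A i j| * c)).
  by apply: ler_sum => j _; rewrite normrM ler_wpM2l.
rewrite -mulr_suml ler_wpM2r // [leRHS](bigD1 i) //= ler_wpDr //.
by apply: sumr_ge0 => l _; apply: sumr_ge0.
Qed.

(** By [powmx_bound], a multiple of the exponential series dominates each entry. *)
Lemma cvg_free_series v i t : cvgn (pseries (free_coef v i) t).
Proof.
pose M : R := \sum_l \sum_j `|A l j|; pose C : R := \sum_j `|v j ord0|.
apply: normed_cvg.
apply: (@series_le_cvg _ _ (fun k => C * exp_coeff (M * `|t|) k)).
- by move=> k; exact: normr_ge0.
- move=> k; apply: mulr_ge0; first exact: sumr_ge0.
  apply: exp_coeff_ge0; apply: mulr_ge0 => //.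
  by rewrite sumr_ge0 // => l _; rewrite sumr_ge0.
- move=> k; rewrite /= /free_coef !normrM normfV normrX normr_nat.
  rewrite /exp_coeff /= exprMn mulrAC !mulrA.
  rewrite ler_pM2r ?invr_gt0 ?ltr0n ?fact_gt0 //.
  by rewrite ler_wpM2r ?exprn_ge0 // powmx_bound.
- exact/(@is_cvg_seriesZ _ _ C)/is_cvg_series_exp_coeff.
Qed.

(** The factor k + 1 from differentiation cancels in (k + 1)!, and the extra power of [A] is
    absorbed into the vector. *)
Lemma free_coef_diffs v i :
  pseries_diffs (free_coef v i) = free_coef (A *m v) i.
Proof.
apply/funext => k; rewrite /pseries_diffs /free_coef mulmxA mulmxE -exprSr.
by rewrite factS natrM invfM mulrCA mulVKf // pnatr_eq0.
Qed.

Lemma mulmx_free_response v t :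
  A *m free_response v t = free_response (A *m v) t.
Proof.
apply/colP => i; rewrite !mxE; apply/esym/cvg_lim => //.
have -> : pseries (free_coef (A *m v) i) t =
    (fun m => \sum_j A i j * pseries (free_coef v j) t m).
  apply/funext => m; rewrite /pseries /series /=.
  under [RHS]eq_bigr do rewrite mulr_sumr.
  rewrite exchange_big /=; apply: eq_bigr => k _.
  rewrite /free_coef mulmxA mulmxE -exprSr exprS -mulmxE -mulmxA mxE.
  by rewrite !mulr_suml; apply: eq_bigr => j _; rewrite !mulrA.
apply: cvg_big => [|j _]; first exact: add_continuous.
by rewrite mxE; apply: cvgMl_tmp; exact: cvg_free_series.
Qed.

Lemma is_derive_free_response v (t : R) :
  is_derive t 1 (free_response v) (A *m free_response v t).
Proof.
apply: (is_derive_mx _ (fun s => A *m free_response v s)) => i j.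
rewrite mulmx_free_response mxE.
have -> : (fun s => free_response v s i j)
    = (fun s => limn (pseries (free_coef v i) s)).
  by apply/funext => s; rewrite mxE.
rewrite -free_coef_diffs.
(* Termwise differentiation needs a point of modulus larger than that of [t] where the series and
   its first two formal derivatives converge. These are the series of [v], [A *m v] and
   [A *m (A *m v)]. *)
apply: (@pseries_snd_diffs _ _ (`|t| + 1)); rewrite ?free_coef_diffs.
- exact: cvg_free_series.
- exact: cvg_free_series.
- exact: cvg_free_series.
- by rewrite [ltRHS]ger0_norm // ltr_pwDr.
Qed.

Lemma free_response0 v : free_response v 0 = v.
Proof.
apply/colP => i; rewrite mxE; apply: cvg_lim => //.
apply/cvgrPdist_le => e e0; near=> m.
rewrite /pseries /series /=.
have m0 : (0 < m)%N by near: m; exact: nbhs_infty_gt.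
rewrite big_ltn // big_nat big1 => [|k /andP[k0 _]]; last first.
  by rewrite expr0n eqn0Ngt k0 mulr0.
by rewrite /free_coef !expr0 mul1mx divr1 mulr1 addr0 subrr normr0 ltW.
Unshelve. all: by end_near. Qed.

End FreeResponse.

(** * Polynomials with prescribed values of [flat_deriv] *)

(* For [f] = p_n and [a i] = - chi_(n - i), this is p_(n - i), and the input [u]
   when [i] = n + 1. *)
Fixpoint flat_deriv {R : nzRingType} (a : nat -> R) (i : nat) (f : {poly R}) :
    {poly R} :=
  if i is i'.+1 then (flat_deriv a i' f)^`() - a i' *: f else f.

Lemma flat_derivD {R : nzRingType} (a : nat -> R) i (f g : {poly R}) :
  flat_deriv a i (f + g) = flat_deriv a i f + flat_deriv a i g.
Proof.
by elim: i => //= i ->; rewrite derivD scalerDr opprD addrACA.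
Qed.

(** Each stage lowers the order of vanishing at [z] by at most one. The subtracted multiples of the
    initial polynomial vanish to higher order, so only differentiation affects the leading value,
    whence the falling factorial. *)
Lemma flat_deriv_zero {R : comNzRingType} (a : nat -> R) (z : R) (r : {poly R})
    (i j : nat) :
  (i <= j)%N -> exists2 q : {poly R},
    flat_deriv a i (('X - z%:P) ^+ j * r) = ('X - z%:P) ^+ (j - i) * q
    & q.[z] = (j ^_ i)%:R * r.[z].
Proof.
elim: i => [|i IHi] ij /=; first by exists r; rewrite ?subn0 ?ffact0n ?mul1r.
have [q -> qz] := IHi (ltnW ij).
have jE : j = ((j - i.+1) + i.+1)%N by rewrite subnK.
rewrite -(subnSK ij) [X in _ ^+ X * r]jE exprD; set l := (j - i.+1)%N.
exists (l.+1%:R *: q + ('X - z%:P) * q^`() - a i *: (('X - z%:P) ^+ i.+1 * r)).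
  rewrite derivM deriv_exp derivXsubC mul1r /= exprSr.
  rewrite [RHS]mulrBr [X in _ = X - _]mulrDr -!scalerAr -!mulrA.
  by rewrite scaler_nat mulrnAl.
rewrite !hornerE /= subrr expr0n mulr0 !mul0r subr0 addr0 qz.
by rewrite ffactnSr natrM -(subnSK ij) -/l mulrA; congr (_ * _); rewrite mulrC.
Qed.

(** Triangular Hermite interpolation at 1: adding [('X - 1%:P) ^+ m * b%:P] to [r] keeps the values
    of index below [m] and shifts the one of index [m] by m! times [b]. *)
Lemma flat_deriv_interp {R : numFieldType} (a c : nat -> R) (l m : nat) :
  exists r : {poly R}, forall i, (i < m)%N ->
    (flat_deriv a i ('X^l * r)).[1] = c i.
Proof.
elim: m => [|m [r IHm]]; first by exists 0.
pose b := (c m - (flat_deriv a m ('X^l * r)).[1]) / m`!%:R.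
exists (r + ('X - 1%:P) ^+ m * b%:P) => i im.
have [q] := flat_deriv_zero a 1 ('X^l * b%:P) i m im.
rewrite mulrDr flat_derivD hornerD (mulrCA 'X^l) => -> qE.
rewrite hornerM horner_exp hornerXsubC subrr expr0n {}qE.
have [lt_im|] := ltnP i m.
  by rewrite subn_eq0 leqNgt lt_im mul0r addr0 IHm.
rewrite leq_eqVlt ltnNge -ltnS im orbF => /eqP <-.
rewrite subnn mul1r ffactnn hornerM hornerXn expr1n hornerC mul1r.
by rewrite /b [m`!%:R * _]mulrC divfK ?subrKC // pnatr_eq0 -lt0n fact_gt0.
Qed.

Lemma scale_above {R : realFieldType} {T : finType} (v w : T -> R) (h : R) :
  (forall i, 0 < v i) -> exists s : R, forall i, h <= w i + s * v i.
Proof.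
move=> v_gt0; exists (\sum_i `|(h - w i) / v i|) => i.
rewrite -lerBlDl -[leLHS](divfK (lt0r_neq0 (v_gt0 i))) ler_pM2r //.
by rewrite (bigD1 i) //= ler_wpDr ?sumr_ge0 // ler_norm.
Qed.

(** * Steering to a positive combination of Krylov vectors *)

Section SingleInput.
Context {R : realType} {n : nat} (A : 'M[R]_n.+1) (b : 'cV[R]_n.+1).
Local Notation krylov k := (A ^+ k *m b).

Lemma krylov_Cayley_Hamilton :
  krylov n.+1 = - \sum_(k < n.+1) (char_poly A)`_k *: krylov k.
Proof.
have := congr1 (mulmx^~ b) (Cayley_Hamilton A).
rewrite mul0mx -{1}[char_poly A]coefK size_char_poly poly_def rmorph_sum /=.
rewrite big_ord_recr /= mulmxDl addrC => /eqP; rewrite addr_eq0 => /eqP.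
have := char_poly_monic A.
rewrite monicE lead_coefE size_char_poly /= => /eqP ->.
rewrite scale1r rmorphXn /= horner_mx_X => ->; congr (- _).
rewrite mulmx_suml; apply: eq_bigr => k _.
by rewrite horner_mxZ rmorphXn /= horner_mx_X -scalemxAl.
Qed.

Section Steering.
Variable c : nat -> R.
Hypothesis c_pos : forall i, 0 < (\sum_(k < n.+1) c k *: krylov k) i ord0.

Lemma dt_herdable_krylov : dt_herdable A b.
Proof.
move=> x0 h h_gt0; exists n.+1; split=> //.
have [s sP] := scale_above _ (fun i => (A ^+ n.+1 *m x0) i ord0) h c_pos.
(* The input at time [t] reaches time [n.+1] through [A ^+ (n - t)], so the coefficients are fed in
   reverse order. *)
pose u t : R := s * c (n - t)%N.
exists (fun t => (u t)%:M).
exists (fun t => A ^+ t *m x0 + \sum_(k < t) u (t - k.+1)%N *: krylov k); split.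
- move=> t _; rewrite big_ord_recl subSS subn0 mul_mx_scalar expr0 mul1mx.
  rewrite mulmxDr exprS -mulmxE -mulmxA -addrA; congr (_ + _).
  rewrite addrC; congr (_ + _); rewrite mulmx_sumr; apply: eq_bigr => k _.
  by rewrite -scalemxAr mulmxA mulmxE -exprS.
- by rewrite expr0 mul1mx big_ord0 addr0.
- move=> i; rewrite mxE; have := sP i; congr (_ <= _ + _).
  rewrite !summxE mulr_sumr; apply: eq_bigr => k _; rewrite !mxE /u mulrA subSS.
  by rewrite subKn // -ltnS.
Qed.

Lemma ct_herdable_krylov : ct_herdable A b.
Proof.
move=> x0 h h_gt0; exists 1; split=> //.
have [s sP] := scale_above _ (fun i => free_response A x0 1 i ord0) h c_pos.
pose a i := - (char_poly A)`_(n - i).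
(* The first [n.+1] is the order of the zero at time 0; the second counts the values prescribed at
   time 1, one for each Krylov vector. *)
have [r rP] := flat_deriv_interp a (fun i => s * c (n - i)%N) n.+1 n.+1.
set f := 'X^_ * r in rP.
pose p k := flat_deriv a (n - k) f.
pose y t := \sum_(k < n.+1) (p k).[t] *: krylov k.
pose u t := (flat_deriv a n.+1 f).[t].
have dy t : is_derive t (1 : R) y (A *m y t + b *m (u t)%:M).
  have -> : A *m y t + b *m (u t)%:M
      = \sum_(k < n.+1) ((p k)^`()).[t] *: krylov k.
    have pE k : (k <= n)%N ->
        ((p k)^`()).[t] = (flat_deriv a (n - k).+1 f).[t]
          - (char_poly A)`_k * f.[t].
      move=> kn; rewrite /= hornerD hornerN hornerZ.
      by rewrite /a subKn // mulNr opprK addrK.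
    (* The terms in the coefficients of [char_poly A] add up to the Krylov vector of index [n.+1],
       which is the top term of [A *m y t]. *)
    have -> : \sum_(k < n.+1) ((p k)^`()).[t] *: krylov k
       = \sum_(k < n.+1) (flat_deriv a (n - k).+1 f).[t] *: krylov k
         + f.[t] *: krylov n.+1.
      rewrite krylov_Cayley_Hamilton scalerN scaler_sumr -sumrB.
      apply: eq_bigr => k _; rewrite pE -1?ltnS // scalerBl scalerA.
      by rewrite [in RHS]mulrC.
    rewrite big_ord_recl subn0 -/(u t) expr0 mul1mx mul_mx_scalar addrC -addrA.
    congr (_ + _).
    rewrite /y big_ord_recr mulmxDr -scalemxAr mulmxA mulmxE -exprS.
    congr (_ + _ *: _); last by rewrite /p /= subnn.
    rewrite mulmx_sumr; apply: eq_bigr => k _.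
    by rewrite -scalemxAr mulmxA mulmxE -exprS /p lift0 subnSK.
  apply: (is_derive_mx _
    (fun t => \sum_(k < n.+1) ((p k)^`()).[t] *: krylov k)) => i j.
  pose q := \sum_(k < n.+1) krylov k i j *: p k.
  have -> : (fun s => y s i j) = horner q.
    apply/funext => s'; rewrite summxE horner_sum; apply: eq_bigr => k _.
    by rewrite mxE hornerZ mulrC.
  have -> : (\sum_(k < n.+1) ((p k)^`()).[t] *: krylov k) i j = (q^`()).[t].
    rewrite summxE raddf_sum horner_sum; apply: eq_bigr => k _.
    by rewrite mxE /= derivZ hornerZ mulrC.
  exact: is_derive_poly.
have dx t : is_derive t (1 : R) (fun t => free_response A x0 t + y t)
    (A *m (free_response A x0 t + y t) + b *m (u t)%:M).
  rewrite mulmxDr -addrA; apply: is_deriveD; exact: is_derive_free_response.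
exists (fun t => (u t)%:M), (fun t => free_response A x0 t + y t); split.
- split.
  + apply: derivable_within_continuous => t _.
    apply/derivable_mxP => i j; rewrite !ord1.
    under eq_fun do rewrite mxE eqxx mulr1n.
    exact: derivable_horner.
  + by apply: derivable_within_continuous => t _; have [] := dx t.
  + by move=> t _; exact: dx.
- rewrite free_response0 /y big1 ?addr0 // => k _.
  (* At most [n] of the [n.+1] factors ['X] are lost, so every [p k] still vanishes at 0. *)
  have ikn : (n - k <= n.+1)%N by rewrite (leq_trans (leq_subr _ _)).
  have [q] := flat_deriv_zero a 0 r (n - k) n.+1 ikn.
  rewrite subr0 /p => -> _; rewrite hornerM hornerXn expr0n subn_eq0.
  by rewrite leqNgt ltnS leq_subr mul0r scale0r.
- move=> i; rewrite mxE; have := sP i; congr (_ <= _ + _).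
  rewrite !summxE mulr_sumr; apply: eq_bigr => k _; rewrite !mxE /p.
  by rewrite rP ?ltnS ?leq_subr // subKn ?mulrA // -ltnS.
Qed.

End Steering.
End SingleInput.

Theorem proposition6 (R : realType) (n : nat) (A : 'M[R]_n.+1) :
  A = A^T ->
  is_tree (mx_edge A) ->
  (forall i j : 'I_n.+1, (i <= j)%N ->
     (gdist (mx_edge A) ord0 i <= gdist (mx_edge A) ord0 j)%N) ->
  (forall d : nat, (d < eccentricity (mx_edge A) ord0)%N ->
     same_sign_edges A (layer (mx_edge A) ord0 d)
                       (layer (mx_edge A) ord0 d.+1)) ->
  herdable A (delta_mx ord0 ord0 : 'cV[R]_n.+1).
Proof.
move=> symA [connA _ _] _ signA.
have [c c_pos] := krylov_pos A symA connA signA.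
split; first exact: ct_herdable_krylov c_pos.
exact: dt_herdable_krylov c_pos.
Qed.
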